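(* Consider the single stage pricing game with linear loyalty described in the context, with parameters $c_A\ge c_B\ge 0$, $l_\alpha,l_\beta>0$, $s_\alpha,s_\beta\ge 0$, $\theta\in(0,1)$, and $F$ the distribution function of the uniform distribution on $[0,1]$. Suppose (Region I) $$l_\beta-s_\beta\le c_A-c_B\le s_\alpha-l_\alpha .$$ Then the game has a unique pure Nash equilibrium, and its prices are $$p_A^\alpha=c_B+s_\alpha,\quad p_A^\beta=c_A,\quad p_B^\beta=c_A+s_\beta,\quad p_B^\alpha=c_B .$$
   Context: Two firms $A$ and $B$ sell the same product, with unit product costs $c_A$ and $c_B$, where $c_A\ge c_B\ge 0$. Customers are partitioned into a set $\alpha$ (ex ante loyal to $A$; a fraction $\theta$ of the market; $A$'s strong and $B$'s weak sub-market) and a set $\beta$ (ex ante loyal to $B$; a fraction $1-\theta$; $B$'s strong and $A$'s weak sub-market). Both firms can tell the two sets apart. Each customer buys exactly one unit, from $A$ or from $B$. Firms move simultaneously: $A$ chooses $(p_A^\alpha,p_A^\beta)$ with $p_A^\alpha,p_A^\beta\ge c_A$, and $B$ chooses $(p_B^\beta,p_B^\alpha)$ with $p_B^\beta,p_B^\alpha\ge c_B$; the superscript is the set of customers to which the price is offered. Linear loyalty: a customer in $\alpha$ has loyalty level $l_\alpha\xi+s_\alpha$ and buys from $A$ iff $l_\alpha\xi+s_\alpha\ge p_A^\alpha-p_B^\alpha$; a customer in $\beta$ has loyalty level $l_\beta\xi+s_\beta$ and buys from $B$ iff $l_\beta\xi+s_\beta\ge p_B^\beta-p_A^\beta$; here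 $\xi$ is random with distribution function $F$. Put $\xi^\alpha=(p_A^\alpha-p_B^\alpha-s_\alpha)/l_\alpha$ and $\xi^\beta=(p_B^\beta-p_A^\beta-s_\beta)/l_\beta$. For the uniform distribution, $F(x)=0$ for $x\le 0$, $F(x)=x$ for $0\le x\le1$, $F(x)=1$ for $x\ge1$. Profits: firm $A$ gets $(p_A^\alpha-c_A)\,\theta\,(1-F(\xi^\alpha))+(p_A^\beta-c_A)(1-\theta)F(\xi^\beta)$; firm $B$ gets $(p_B^\beta-c_B)(1-\theta)(1-F(\xi^\beta))+(p_B^\alpha-c_B)\,\theta\,F(\xi^\alpha)$. A pure Nash equilibrium is a price profile $(p_A^\alpha,p_A^\beta,p_B^\beta,p_B^\alpha)$ from which neither firm can strictly increase its profit by unilaterally changing its own (feasible) prices. *)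

(* Defs.v *)
From mathcomp Require Import all_boot all_order all_algebra.
From mathcomp Require Import all_classical all_reals all_analysis.

Set Implicit Arguments.
Unset Strict Implicit.
Unset Printing Implicit Defensive.

Import Order.TTheory GRing.Theory Num.Theory.
Local Open Scope classical_set_scope.
Local Open Scope ring_scope.

Record market (R : realType) := Market {
  costA : R;
  costB : R;
  l_alpha : R;
  s_alpha : R;
  l_beta : R;
  s_beta : R;
  theta : R (* fraction of the customers who are ex ante loyal to A *)
}.

(* The pair of prices posted by one firm, one for each set of customers. *)
Record prices (R : realType) := Prices {
  price_alpha : R;
  price_beta : R
}.

Section Game.
Variables (R : realType) (F : R -> R) (M : market R).
Implicit Types a b : prices R. (* the prices of firm A and of firm B *)

(* A customer of alpha (resp. beta) whose loyalty level is l * xi + s stays with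
   A (resp. B) iff xi is at least the following threshold, which happens for a
   fraction 1 - F (threshold) of that sub-market. *)
Definition xi_alpha a b : R :=
  (price_alpha a - price_alpha b - s_alpha M) / l_alpha M.

Definition xi_beta a b : R :=
  (price_beta b - price_beta a - s_beta M) / l_beta M.

Definition profitA a b : R :=
  (price_alpha a - costA M) * theta M * (1 - F (xi_alpha a b))
  + (price_beta a - costA M) * (1 - theta M) * F (xi_beta a b).

Definition profitB a b : R :=
  (price_beta b - costB M) * (1 - theta M) * (1 - F (xi_beta a b))
  + (price_alpha b - costB M) * theta M * F (xi_alpha a b).

Definition feasibleA a : Prop :=
  costA M <= price_alpha a /\ costA M <= price_beta a.

Definition feasibleB b : Prop :=
  costB M <= price_alpha b /\ costB M <= price_beta b.

Definition is_nash (p : prices R * prices R) : Prop :=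
  [/\ feasibleA p.1,
      feasibleB p.2,
      forall a, feasibleA a -> profitA a p.2 <= profitA p.1 p.2 &
      forall b, feasibleB b -> profitB p.1 b <= profitB p.1 p.2].

End Game.

Definition uniform_cdf (R : realType) (x : R) : R :=
  if x <= 0 then 0 else if x <= 1 then x else 1.

Lemma uniform_cdfE (R : realType) (x : R) :
  uniform_prob (@ltr01 R) `]-oo, x] = (uniform_cdf x)%:E.
Proof.
rewrite /uniform_prob integral_uniform_pdf.
have -> : `]-oo, x] `&` `[0, 1] = [set` `[0, Num.min x 1]] :> set R.
  apply/seteqP; split => y /=; rewrite !in_itv /= le_min.
    by move=> [-> /andP[-> ->]].
  by move=> /and3P[-> -> ->].
rewrite (eq_integral (fun=> 1%:E)); last first.
  move=> y; rewrite inE /= in_itv /= le_min => /and3P[y0 _ y1].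
  by rewrite /uniform_pdf y0 y1 subr0 invr1.
rewrite integral_cst//= mul1e lebesgue_measure_itv /= lte_fin lt_min ltr01 andbT.
rewrite /uniform_cdf; case: (leP x 0) => // x0.
by rewrite -EFinD subr0; case: (leP x 1).
Qed.

(* Main.v *)
Require Import Defs.
From mathcomp Require Import all_boot all_order all_algebra.
From mathcomp Require Import reals.
From mathcomp Require Import ring lra.
Local Open Scope ring_scope.

(**
Both profits are sums of a term depending only on the prices in alpha and a term
depending only on the prices in beta, with positive weights, so the game splits
into two independent one-price games between a strong firm (cost c, price p) and
a weak firm (cost k, price q). Both satisfy the same condition
l <= k + s - c, which makes the margin of the strong firm so large that it never
gains by giving up customers: its best reply to q is to keep the whole segment
at price q + s. The weak firm then sells nothing, and would profitably undercut
any q > k; hence q = k and p = k + s.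
*)

Import Order.TTheory GRing.Theory Num.Theory.

Definition strong_profit {R : realType} (F : R -> R) (l s c p q : R) : R :=
  (p - c) * (1 - F ((p - q - s) / l)).

Definition weak_profit {R : realType} (F : R -> R) (l s k p q : R) : R :=
  (q - k) * F ((p - q - s) / l).

Definition segment_nash {R : realType} (F : R -> R) (l s c k p q : R) : Prop :=
  [/\ c <= p, k <= q,
      forall p', c <= p' -> strong_profit F l s c p' q <= strong_profit F l s c p q &
      forall q', k <= q' -> weak_profit F l s k p q' <= weak_profit F l s k p q].

(** Changing one price of one firm leaves the term of the other segment fixed, so it cancels and the
    positive weight divides out; conversely, the weighted segment inequalities add up. In beta the
    roles are exchanged: [B] is strong and [A] is weak. *)
Lemma is_nash_segments {R : realType} (F : R -> R) (M : market R)
    (theta_gt0 : 0 < theta M) (theta_lt1 : theta M < 1) (a b : prices R) :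
  is_nash F M (a, b) <->
  segment_nash F (l_alpha M) (s_alpha M) (costA M) (costB M)
    (price_alpha a) (price_alpha b) /\
  segment_nash F (l_beta M) (s_beta M) (costB M) (costA M)
    (price_beta b) (price_beta a).
Proof.
have theta'_gt0 : 0 < 1 - theta M by rewrite subr_gt0.
have EA a' b' : profitA F M a' b' =
    theta M * strong_profit F (l_alpha M) (s_alpha M) (costA M)
                (price_alpha a') (price_alpha b') +
    (1 - theta M) * weak_profit F (l_beta M) (s_beta M) (costA M)
                (price_beta b') (price_beta a').
  by rewrite /profitA /strong_profit /weak_profit /xi_alpha /xi_beta; ring.
have EB a' b' : profitB F M a' b' =
    (1 - theta M) * strong_profit F (l_beta M) (s_beta M) (costB M)
                (price_beta b') (price_beta a') +
    theta M * weak_profit F (l_alpha M) (s_alpha M) (costB M)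
                (price_alpha a') (price_alpha b').
  by rewrite /profitB /strong_profit /weak_profit /xi_alpha /xi_beta; ring.
split.
  move=> [[/= cA_a cA_a'] [/= cB_b cB_b'] optA optB].
  split; split=> // x hx.
  - have := optA (Prices x (price_beta a)) (conj hx cA_a').
    by rewrite !EA /= lerD2r ler_pM2l.
  - have := optB (Prices x (price_beta b)) (conj hx cB_b').
    by rewrite !EB /= lerD2l ler_pM2l.
  - have := optB (Prices (price_alpha b) x) (conj cB_b hx).
    by rewrite !EB /= lerD2r ler_pM2l.
  - have := optA (Prices (price_alpha a) x) (conj cA_a hx).
    by rewrite !EA /= lerD2l ler_pM2l.
move=> [[cA_a cB_b sA wB] [cB_b' cA_a' sB wA]]; split=> //= x [x_alpha x_beta].
  by rewrite !EA lerD// ler_pM2l//; [exact: sA | exact: wA].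
by rewrite !EB lerD// ler_pM2l//; [exact: sB | exact: wB].
Qed.

Lemma uniform_cdf_gt0 {R : realType} {x : R} : 0 < x -> 0 < uniform_cdf x.
Proof. by rewrite /uniform_cdf; case: (leP x 0) => //; case: (leP x 1). Qed.

Lemma uniform_cdf_le0 {R : realType} {x : R} : x <= 0 -> uniform_cdf x = 0.
Proof. by rewrite /uniform_cdf => ->. Qed.

(** With threshold [t] and [m = q + s - c], the profit is [(m + l * t) * (1 - F t)]: for [t < 0] the
    price drops without gaining customers, for [t > 1] nothing is sold. The equality case makes the
    maximizer unique. *)
Lemma strong_best_reply {R : realType} {l s c q : R} (p : R) :
  0 < l -> l <= q + s - c ->
  strong_profit (@uniform_cdf R) l s c p q <= q + s - c ?= iff (p == q + s).
Proof.
move=> l_gt0 margin; rewrite /strong_profit; set t := (p - q - s) / l.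
have -> : p = q + s + l * t by rewrite /t; field; rewrite gt_eqF.
have -> : (q + s + l * t == q + s) = (t == 0).
  by rewrite -subr_eq0 addrAC subrr add0r mulf_eq0 gt_eqF.
apply/leifP; rewrite /uniform_cdf; clearbody t.
case: (ltgtP t 0) => [t_lt0|t_gt0|->]; last by apply/eqP; ring.
  by rewrite subr0 mulr1; have : l * t < 0; [rewrite pmulr_rlt0 | lra].
case: (leP t 1) => [t_le1|_]; last by lra.
(* For [0 < t <= 1] the profit is [m - (m - l) * t - l * t ^+ 2]; the quadratic term keeps the
   inequality strict even if [m = l]. *)
have : 0 < l * t ^+ 2 by rewrite mulr_gt0// exprn_gt0.
have : l * t <= (q + s - c) * t by rewrite ler_pM2r.
lra.
Qed.

Lemma segment_nash_uniform {R : realType} (l s c k p q : R) :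
  0 < l -> l <= k + s - c ->
  segment_nash (@uniform_cdf R) l s c k p q <-> p = k + s /\ q = k.
Proof.
move=> l_gt0 margin; split=> [[c_le_p k_le_q optS optW]|[-> ->]].
  have margin_q : l <= q + s - c by lra.
  have Ep : p = q + s.
    apply/eqP; rewrite -(ge_leif (strong_best_reply p l_gt0 margin_q)).
    have [_] := strong_best_reply (q + s) l_gt0 margin_q.
    by rewrite eqxx => /eqP <-; apply: optS; lra.
  suff Eq : q = k by rewrite Ep Eq.
  apply/eqP; rewrite eq_le k_le_q andbT leNgt; apply/negP => k_lt_q.
  (* Undercutting to the midpoint gives threshold [(q - k) / (2 * l) > 0], hence positive sales at a
     positive margin. *)
  have /optW : k <= (q + k) / 2 by lra.
  rewrite {}Ep /weak_profit.
  have -> : q + s - q - s = 0 by ring.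
  rewrite mul0r (uniform_cdf_le0 (lexx 0)) mulr0 leNgt mulr_gt0//; first by lra.
  by apply: uniform_cdf_gt0; rewrite divr_gt0//; lra.
split=> [||p' _|q' k_le_q']; [lra | by [] | |].
  have [_] := strong_best_reply (k + s) l_gt0 margin.
  by rewrite eqxx => /eqP ->; exact: strong_best_reply.
(* Against [p = k + s], any [q'] at or above cost has threshold [(k - q') / l <= 0] and sells
   nothing. *)
rewrite /weak_profit subrr mul0r uniform_cdf_le0 ?mulr0//.
by rewrite pmulr_lle0 ?invr_gt0//; lra.
Qed.

Theorem proposition3 (R : realType) (M : market R)
    (hcB : 0 <= costB M) (hcAB : costB M <= costA M)
    (hl_alpha : 0 < l_alpha M) (hl_beta : 0 < l_beta M)
    (hs_alpha : 0 <= s_alpha M) (hs_beta : 0 <= s_beta M)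
    (htheta0 : 0 < theta M) (htheta1 : theta M < 1)
    (hI_beta : l_beta M - s_beta M <= costA M - costB M)
    (hI_alpha : costA M - costB M <= s_alpha M - l_alpha M) :
  (exists! p : prices R * prices R, is_nash (@uniform_cdf R) M p) /\
  (forall p : prices R * prices R, is_nash (@uniform_cdf R) M p ->
    [/\ price_alpha p.1 = costB M + s_alpha M,
        price_beta p.1 = costA M,
        price_beta p.2 = costA M + s_beta M &
        price_alpha p.2 = costB M]).
Proof.
have nashE a b : is_nash (@uniform_cdf R) M (a, b) <->
    (price_alpha a = costB M + s_alpha M /\ price_alpha b = costB M) /\
    (price_beta b = costA M + s_beta M /\ price_beta a = costA M).
  (* The two Region I inequalities, rearranged, are the margin conditions of the two segments. *)
  rewrite is_nash_segments// !segment_nash_uniform//; lra.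
split; last by move=> [a b] /nashE[[? ?] [? ?]].
exists (Prices (costB M + s_alpha M) (costA M),
        Prices (costB M) (costA M + s_beta M)); split; first exact/nashE.
by move=> [[? ?] [? ?]] /nashE /= [[-> ->] [-> ->]].
Qed.
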